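(* Let $p$ be a prime with $p\equiv 1$ or $3\pmod 8$, and let $Q\subset GF(p)^\times$ be the set of quadratic residues. Then $$|X_Q(GF(p))|=1.5\,p+a$$ for some real number $a$ with $-\frac12\le a\le\frac52$.
   Context: For an odd prime $p$ and a non-empty subset $S\subseteq GF(p)$ let $f_S(x)=\prod_{a\in S}(x-a)\in GF(p)[x]$, and let $X_S$ be the hyperelliptic curve $y^2=f_S(x)$. $|X_S(GF(p))|$ denotes the number of solutions $(x,y)\in GF(p)^2$ of $y^2=f_S(x)$ plus the number of points at infinity, which is $2$ if $|S|$ is even and $1$ if $|S|$ is odd. *)

(* Defs.v *)
From HB Require Import structures.
From mathcomp Require Import all_boot all_order all_algebra.
From mathcomp Require Import reals.

Set Implicit Arguments.
Unset Strict Implicit.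
Unset Printing Implicit Defensive.

Import GRing.Theory.
Local Open Scope ring_scope.

Definition root_poly (p : nat) (S : {set 'F_p}) : {poly 'F_p} :=
  \prod_(a in S) ('X - a%:P).

Definition affine_points (p : nat) (S : {set 'F_p}) : {set 'F_p * 'F_p} :=
  [set P | P.2 ^+ 2 == (root_poly S).[P.1]].

Definition nb_points_at_infinity (p : nat) (S : {set 'F_p}) : nat :=
  if odd #|S| then 1 else 2.

(* |X_S(GF(p))| for the curve X_S : y^2 = f_S(x), meant for p an odd prime
   and S non-empty. *)
Definition nb_points (p : nat) (S : {set 'F_p}) : nat :=
  (#|affine_points S| + nb_points_at_infinity S)%N.

(* Quadratic residues are taken in GF(p)^*, so 0 is excluded. *)
Definition quadratic_residues (p : nat) : {set 'F_p} :=
  [set a | (a != 0) && [exists b : 'F_p, a == b ^+ 2]].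

(* Main.v *)
(* Put m = (p - 1) / 2, so that f_Q = X^m - 1 takes the value 0 on Q, -2 on the
   nonresidues and -1 at 0. Since -2 is a residue, Q contributes m points and the
   nonresidues 2m points; 0 contributes 2 points or none according to whether -1
   is a residue, i.e. to the parity of m, which also decides the number of points
   at infinity. *)

Require Import Defs.
From HB Require Import structures.
From mathcomp Require Import all_boot all_order all_algebra.
From mathcomp Require Import reals.
From mathcomp Require Import all_field.
From mathcomp Require Import zify ring lra.

Set Implicit Arguments.
Unset Strict Implicit.
Unset Printing Implicit Defensive.

Import Order.TTheory GRing.Theory Num.Theory.
Local Open Scope ring_scope.

Lemma card_square_roots (p : nat) (p_prime : prime p) (p_gt2 : (2 < p)%N)
    (a : 'F_p) :
  #|[set y | y ^+ 2 == a]| =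
    (if a == 0%R then 1 else if a \in quadratic_residues p then 2 else 0)%N.
Proof.
have [-> | a_neq0] := eqVneq a 0.
  by rewrite -[RHS](cards1 (0 : 'F_p)); apply: eq_card => y; rewrite !inE; rewrite sqrf_eq0.
rewrite inE a_neq0 /=; case: existsP => [[b /eqP def_a] | no_root]; last first.
  apply/eqP; rewrite cards_eq0 -subset0; apply/subsetP => y; rewrite !inE.
  by move=> /eqP def_a; case: no_root; exists y; rewrite def_a.
have b_neq0 : b != 0 by rewrite -sqrf_eq0 -def_a.
have b_neqN : b != - b.
  rewrite -addr_eq0 -mulr2n -mulr_natl mulf_neq0 //.
  by rewrite -(dvdn_pcharf (pchar_Fp p_prime)) gtnNdvd.
rewrite (_ : [set y | _] = [set b; - b]) ?cards2 ?b_neqN //.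
by apply/setP => y; rewrite !inE def_a eqf_sqr.
Qed.

(** Squaring maps the [2m] nonzero elements onto the residues, and each fibre is a pair [b],
    [- b]. *)
Lemma card_quadratic_residues (p m : nat) (p_prime : prime p)
    (def_p : p = m.*2.+1) : #|quadratic_residues p| = m.
Proof.
have p_gt2 : (2 < p)%N by rewrite odd_prime_gt2 // def_p /= odd_double.
have : #|[set~ (0 : 'F_p)]| = m.*2 by rewrite cardsC1 card_Fp // def_p.
rewrite -sum1_card.
rewrite (partition_big (fun y => y ^+ 2) (mem (quadratic_residues p))) /=; last first.
  by move=> y; rewrite !inE sqrf_eq0 => ->; apply/existsP; exists y.
rewrite (eq_bigr (fun=> 2%N)) => [|a aQ].
  by rewrite sum_nat_const muln2 => /double_inj.
have a_neq0 : a != 0 by case/setIdP: aQ.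
transitivity #|[set y : 'F_p | y ^+ 2 == a]|.
  rewrite -sum1_card; apply: eq_bigl => y; rewrite !inE.
  by case: (y ^+ 2 =P a) => [def_a|_]; rewrite ?andbF // andbT -sqrf_eq0 def_a.
by rewrite card_square_roots // (negPf a_neq0) aQ.
Qed.

(** The polynomial ['X^m - 1] is monic of degree [m] and vanishes at each of the [m] residues, so it
    splits into exactly these linear factors. *)
Lemma root_poly_quadratic_residues (p m : nat) (p_prime : prime p)
    (def_p : p = m.*2.+1) :
  root_poly (quadratic_residues p) = 'X^m - 1.
Proof.
have m_gt0 : (0 < m)%N by case: m def_p p_prime => // ->.
set Q := quadratic_residues p; set q := 'X^m - 1.
have q_monic : q \is monic by rewrite monicXnsubC.
rewrite /root_poly -big_enum /=.
have := @all_roots_prod_XsubC _ q (enum Q).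
rewrite (monicP q_monic) scale1r => -> //.
- by rewrite size_XnsubC // -cardE (card_quadratic_residues p_prime def_p).
- apply/allP => a; rewrite mem_enum inE => /andP[a_neq0 /existsP[b /eqP def_a]].
  have b_neq0 : b != 0 by rewrite -sqrf_eq0 -def_a.
  rewrite rootE !hornerE def_a -exprM mul2n subr_eq0.
  (* Fermat's [b ^+ p = b], divided by [b], gives [b ^+ (2 * m) = 1]. *)
  apply/eqP/(mulfI b_neq0); rewrite -exprS -def_p mulr1.
  by have := expf_card b; rewrite card_Fp.
by rewrite uniq_rootsE enum_uniq.
Qed.

(** Membership means being a root of the product over the residues, and that product is
    ['X^m - 1]. *)
Lemma Euler_criterion (p m : nat) (p_prime : prime p) (def_p : p = m.*2.+1)
    (a : 'F_p) :
  (a \in quadratic_residues p) = (a ^+ m == 1).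
Proof.
have := root_poly_quadratic_residues p_prime def_p.
rewrite /root_poly -big_enum => def_f.
by rewrite -mem_enum -root_prod_XsubC def_f rootE !hornerE subr_eq0.
Qed.

(* If z is a primitive 8th root of unity, then w = z + z^3 satisfies
   w^2 = -2, and w is fixed by the Frobenius as p = 1, 3 mod 8. *)
Lemma Fp_neg2_residue (p : nat) (p_prime : prime p)
    (p_mod8 : p = 1 %[mod 8] \/ p = 3 %[mod 8]) :
  - 2 \in quadratic_residues p.
Proof.
have p_odd : odd p by case: p_mod8; lia.
have def_p : p = p./2.*2.+1 by rewrite -[LHS]odd_double_half p_odd.
rewrite (Euler_criterion p_prime def_p).
have [K [iota _]] := countable_algebraic_closure 'F_p.
have pcharK : p \in [pchar K] by rewrite (fmorph_pchar iota) pchar_Fp.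
have [z] : exists z, root ('X^4 + 1 : {poly K}) z.
  by apply/closed_rootP; rewrite size_XnaddC.
rewrite rootE !hornerE addr_eq0 => /eqP z4.
have z8 : z ^+ 8 = 1 by rewrite (exprM z 4 2) z4 sqrrN expr1n.
pose w := z + z ^+ 3.
have w2 : w ^+ 2 = - 2.
  (* The expansion is grouped so that [z ^+ 4 = - 1] kills the first term and leaves [- 2]. *)
  have -> : w ^+ 2 = z ^+ 2 * (1 + z ^+ 4) + 2 * z ^+ 4 by rewrite /w; ring.
  by rewrite z4; ring.
have w_neq0 : w != 0.
  rewrite -sqrf_eq0 w2 oppr_eq0 -(dvdn_pcharf pcharK) gtnNdvd //.
  exact: odd_prime_gt2.
have wp : w ^+ p = w.
  rewrite -(pFrobenius_autE pcharK) rmorphD rmorphXn /= pFrobenius_autE.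
  (* Exponents of [z] count modulo 8: for [p = 1] both terms of [w] are fixed, for [p = 3] they are
     swapped, since [z ^+ 9 = z]. *)
  rewrite -(expr_mod p z8); case: p_mod8 => -> /=; first by rewrite expr1.
  by rewrite -exprM -(expr_mod 9 z8) addrC.
(* Euler's criterion is checked in [K]: there [(- 2) ^+ m = w ^+ (p - 1)] with [m = p./2], and this
   is 1 because [w ^+ p = w] and [w] is nonzero. *)
rewrite -(fmorph_eq1 iota) rmorphXn rmorphN rmorph_nat -w2 -exprM mul2n.
by apply/eqP/(mulfI w_neq0); rewrite -exprS -def_p mulr1.
Qed.

Lemma nb_points_quadratic_residues (p m : nat) (p_prime : prime p)
    (def_p : p = m.*2.+1) (m2_residue : - 2 \in quadratic_residues p) :
  nb_points (quadratic_residues p) = if odd m then (m * 3 + 1)%N else (m * 3 + 4)%N.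
Proof.
set Q := quadratic_residues p in m2_residue *.
have p_gt2 : (2 < p)%N by rewrite odd_prime_gt2 // def_p /= odd_double.
have m_gt0 : (0 < m)%N by move: p_gt2; rewrite def_p; case: (m).
have cardQ : #|Q| = m := card_quadratic_residues p_prime def_p.
have Q0 : 0 \notin Q by rewrite inE eqxx.
have two_neq0 : (2 : 'F_p) != 0.
  by rewrite -(dvdn_pcharf (pchar_Fp p_prime)) gtnNdvd.
have N1Q : (- 1 \in Q) = ~~ odd m.
  rewrite (Euler_criterion p_prime def_p) -signr_odd; case: (odd m).
    by rewrite expr1 eq_sym -addr_eq0; apply: negPf.
  by rewrite eqxx.
(* The affine points are counted fibre by fibre over the [x]-coordinate. *)
have -> : nb_points Q = (\sum_x #|[set y : 'F_p | (y ^+ 2 == x ^+ m - 1)%R]|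
                          + (if odd m then 1 else 2))%N.
  rewrite /nb_points /nb_points_at_infinity cardQ; congr (_ + _)%N.
  rewrite -sum1_card (eq_bigl (fun P => P.2 ^+ 2 == P.1 ^+ m - 1)) => [|P].
    rewrite -(pair_big_dep xpredT (fun x y => y ^+ 2 == x ^+ m - 1) (fun _ _ => 1%N)).
    by apply: eq_bigr => x _; rewrite -sum1_card; apply: eq_bigl => y; rewrite inE.
  by rewrite inE (root_poly_quadratic_residues p_prime def_p) !hornerE.
(* At [x = 0] the right-hand side is [- 1], as [m] is positive. *)
rewrite (bigD1 0) //= (bigID (mem Q)) /= expr0n gtn_eqF // sub0r.
rewrite card_square_roots // oppr_eq0 oner_eq0 N1Q.
have -> : (\sum_(x | (x != 0%R) && (x \in Q))
            #|[set y : 'F_p | (y ^+ 2 == x ^+ m - 1)%R]| = m)%N.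
  rewrite -[RHS]cardQ -sum1_card; apply: eq_big => [x|x /andP[_]].
    by case: eqP => // ->; rewrite (negPf Q0).
  rewrite (Euler_criterion p_prime def_p) => /eqP ->.
  by rewrite subrr card_square_roots // eqxx.
have -> : (\sum_(x | (x != 0%R) && (x \notin Q))
            #|[set y : 'F_p | (y ^+ 2 == x ^+ m - 1)%R]| = m * 2)%N.
  rewrite (eq_bigr (fun=> 2%N)) => [|x /andP[x_neq0]].
    rewrite sum_nat_const; congr (_ * 2)%N.
    transitivity #|~: (0 |: Q)|.
      by apply: eq_card => x; rewrite in_setC in_setU1 negb_or.
    have := cardsC (0 |: Q); rewrite cardsU1 Q0 cardQ card_Fp //.
    lia.
  rewrite (Euler_criterion p_prime def_p) => xm_neq1.
  (* By Fermat [x ^+ m] is a square root of 1, and it is not 1 at a nonresidue, so it is [- 1] and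
     the fibre is [y ^+ 2 = - 2]. *)
  have : (x ^+ m) ^+ 2 == 1.
    rewrite -exprM muln2; apply/eqP/(mulfI x_neq0).
    by rewrite -exprS -def_p mulr1 -[RHS]expf_card card_Fp.
  rewrite sqrf_eq1 (negPf xm_neq1) => /eqP ->.
  rewrite -opprD card_square_roots // oppr_eq0 (negPf two_neq0).
  by rewrite m2_residue.
by case: (odd m) => /=; lia.
Qed.

Theorem lemma8 (R : realType) (p : nat) (p_prime : prime p)
    (p_mod8 : p = 1 %[mod 8] \/ p = 3 %[mod 8]) :
  exists a : R,
    (nb_points (quadratic_residues p))%:R = 3 / 2 * p%:R + a
    /\ - (1 / 2) <= a <= 5 / 2.
Proof.
have p_odd : odd p by case: p_mod8; lia.
have def_p : p = p./2.*2.+1 by rewrite -[LHS]odd_double_half p_odd.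
have m2_residue := Fp_neg2_residue p_prime p_mod8.
rewrite (nb_points_quadratic_residues p_prime def_p m2_residue).
set m := p./2 in def_p *.
have -> : p%:R = 2 * m%:R + 1 :> R by rewrite {1}def_p -addn1 natrD -mul2n natrM.
(* Since [3 / 2 * p = 3 * m + 3 / 2], the counts [3 * m + 1] and [3 * m + 4] leave exactly the two
   endpoints of the interval. *)
by case: (odd m); [exists (- (1 / 2)) | exists (5 / 2)];
  rewrite natrD natrM; split; lra.
Qed.
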